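(* Let $q$ be an odd prime power and $\alpha$ a primitive element of $\mathbb F_q$. For $i=0,1$ define $C_i=\{z\in\mathbb Z_{q-1}\mid \alpha^z\in D_i^2-1\}$, where $D_i^2-1=\{d-1\mid d\in D_i^2\}$. Let $\infty$ be a new point and let $\operatorname{Dev}^\infty C_0$ denote the collection of blocks $(C_0+g)\cup\{\infty\}$, $g\in\mathbb Z_{q-1}$. Then the incidence structure $(\mathbb Z_{q-1}\cup\{\infty\},\ \operatorname{Dev}^\infty C_0\cup\operatorname{Dev}C_1)$, where $\operatorname{Dev}C_1=\{C_1+g\mid g\in\mathbb Z_{q-1}\}$, is a $2$-$(q,\frac{q-1}{2},\frac{q-5}{2})$ adesign.
   Context: $D_0^2=\langle\alpha^2\rangle$ is the set of nonzero squares of $\mathbb F_q$ and $D_1^2=\alpha D_0^2$ the set of non-squares (cyclotomic classes of order 2). A $t$-$(v,k,\lambda)$ adesign is an incidence structure with $v$ points and blocks of size $k$ such that every $t$-subset of points lies in exactly $\lambda$ or exactly $\lambda+1$ blocks, both values occurring.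
   Formalization: The case q = 3 is excluded (q is taken to be at least 5), since for q = 3 the parameter (q-5)/2 equals -1, every pair of points lies in 0 blocks, and the value -1 cannot occur. *)

(* Defs.v *)
From HB Require Import structures.
From mathcomp Require Import all_boot all_order all_algebra.

Set Implicit Arguments.
Unset Strict Implicit.
Unset Printing Implicit Defensive.

Import GRing.Theory.
Local Open Scope ring_scope.

Definition rep_num (P : finType) (B : {set {set P}}) (T : {set P}) : nat :=
  #|[set b in B | T \subset b]|.

Definition is_adesign (P : finType) (B : {set {set P}})
    (t v k lambda : nat) : Prop :=
  [/\ #|P| = v,
      forall b : {set P}, b \in B -> #|b| = k,
      forall T : {set P}, #|T| = t ->
        rep_num B T = lambda \/ rep_num B T = lambda.+1,
      exists T : {set P}, #|T| = t /\ rep_num B T = lambda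
    & exists T : {set P}, #|T| = t /\ rep_num B T = lambda.+1].

(* alpha ^ i * <alpha ^ 2>.  For alpha != 0 the order of alpha ^ 2 divides
   #|F| - 1, so the exponents k < #|F| - 1 reach the whole cyclic group. *)
Definition cyclotomic_class2 (F : finFieldType) (alpha : F) (i : nat) : {set F} :=
  [set alpha ^+ i * (alpha ^+ 2) ^+ k | k : 'I_(#|F|.-1)].

(* 'Z_n is the ring of integers mod n only for 1 < n, hence this models
   Z_(q-1) when q = #|F| > 2; alpha ^+ z uses the representative z < q - 1. *)
Definition log_shifted_class (F : finFieldType) (alpha : F) (i : nat) :
    {set 'Z_(#|F|.-1)} :=
  [set z : 'Z_(#|F|.-1) |
    alpha ^+ z \in [set d - 1 | d in cyclotomic_class2 alpha i]].

Definition translate (G : finZmodType) (C : {set G}) (g : G) : {set G} :=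
  [set c + g | c in C].

(* The point set G together with a new point is option G, None being the new
   point; Dev C is taken as a set of blocks on these points. *)
Definition dev (G : finZmodType) (C : {set G}) : {set {set option G}} :=
  [set Some @: translate C g | g : G].

Definition dev_infty (G : finZmodType) (C : {set G}) : {set {set option G}} :=
  [set None |: (Some @: translate C g) | g : G].

(* Main.v *)
(** Write [n = q - 1], [D_i] for the cyclotomic classes and [c = alpha ^ w].
    The translates of [C_0] and [C_1] containing two finite points with
    difference [w != 0] correspond to the [x != 0] such that [x + 1] and
    [c x + 1] lie in the same class, i.e. such that [(x + 1) / (c x + 1)] is a
    nonzero square.  This Moebius map sends the admissible [x] bijectively onto
    the values other than [0], [1] and [1 / c], so there are
    [n / 2 - 1 - (c is a square)] such translates.

    The blocks form a set and not a multiset, so distinct shifts must give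
    distinct blocks.  For [C_1] the count above is less than [n / 2], the size
    of [C_1].  If [C_0 + w = C_0] with [w != 0], the count leaves no pair of
    difference [w] in [C_1], so [C_1 + w] avoids [C_0] and [C_1] and lies in
    the singleton of the logarithm of [-1], although [C_1] has at least two
    elements. *)
Require Import Defs.
From mathcomp Require Import all_boot all_order all_algebra all_field.
From mathcomp Require Import ring zify.

(** * Translates in a finite abelian group and pair counts *)

Section Translates.
Set Implicit Arguments.
Unset Strict Implicit.
Unset Printing Implicit Defensive.
Import GRing.Theory.
Local Open Scope ring_scope.

Variable G : finZmodType.
Implicit Types (C : {set G}) (g w x y z : G).

Definition differences C w : {set G} := [set z in C | z + w \in C].

Lemma mem_translate C g x : (x \in translate C g) = (x - g \in C).
Proof.
apply/imsetP/idP => [[c cC ->]|xC]; first by rewrite addrK.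
by exists (x - g); rewrite ?subrK.
Qed.

Lemma card_translate C g : #|translate C g| = #|C|.
Proof. by apply: card_imset; exact: addIr. Qed.

(** If [C + g = C + h], then adding [g - h] maps [C] into itself, so [differences C (g - h)] is all
    of [C]. *)
Lemma translate_inj C :
  (forall w, w != 0 -> (#|differences C w| < #|C|)%N) ->
  injective (translate C).
Proof.
move=> small g h eq_gh; apply/eqP; rewrite -subr_eq0; apply/negPn/negP.
move=> /small; rewrite ltnNge => /negP; apply; apply: subset_leq_card.
apply/subsetP => z zC; rewrite inE zC addrA -mem_translate -eq_gh.
by rewrite mem_translate addrK.
Qed.

(** A shift that maps the finite set [C] into itself permutes it, hence an equivalence also for [z]
    outside [C]. *)
Lemma differences_stable C w : (#|C| <= #|differences C w|)%N ->
  forall z, (z + w \in C) = (z \in C).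
Proof.
move=> card_le z; have diffC : differences C w = C.
  apply/eqP; rewrite eqEcard card_le andbT.
  by apply/subsetP => u; rewrite inE => /andP[].
have eqCw : translate C w = C.
  apply/eqP; rewrite eqEcard card_translate leqnn andbT.
  apply/subsetP => u; rewrite mem_translate -{1}diffC inE subrK.
  by case/andP.
by rewrite -[in LHS]eqCw mem_translate addrK.
Qed.

Lemma card_containing C x : #|[set g | x - g \in C]| = #|C|.
Proof.
rewrite -[RHS](card_imset _ (inj_comp (addrI x) oppr_inj)) /=.
apply: eq_card => g; rewrite inE.
apply/idP/imsetP => [xC|[c cC ->]] /=; last by rewrite opprB addrC subrK.
by exists (x - g); rewrite //= opprB addrC subrK.
Qed.

Lemma card_containing_pair C x y :
  #|[set g | (x - g \in C) && (y - g \in C)]| = #|differences C (y - x)|.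
Proof.
rewrite -(card_containing (differences C (y - x)) x).
by apply: eq_card => g; rewrite !inE [x - g + _]addrC addrA subrK.
Qed.

(** Passes from counting blocks to counting shifts; without injectivity, equal blocks would merge in
    the set. *)
Lemma rep_num_imset (P : finType) (f : G -> {set P}) (T : {set P}) :
  injective f -> rep_num [set f g | g : G] T = #|[set g | T \subset f g]|.
Proof.
move=> f_inj; rewrite -(card_imset _ f_inj); apply: eq_card => b.
rewrite inE; apply/andP/imsetP => [[/imsetP[g _ ->] Tg]|[g]].
  by exists g; rewrite ?inE.
by rewrite inE => Tg ->; split; first exact: imset_f.
Qed.

Lemma rep_numU (P : finType) (A B : {set {set P}}) (T : {set P}) :
  [disjoint A & B] -> rep_num (A :|: B) T = (rep_num A T + rep_num B T)%N.
Proof.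
move=> dAB; rewrite /rep_num.
have -> : [set b in A :|: B | T \subset b] =
    [set b in A | T \subset b] :|: [set b in B | T \subset b].
  by apply/setP => b; rewrite !inE andb_orl.
apply/eqP; rewrite leq_card_setU disjoints_subset; apply/subsetP => b.
by rewrite !inE => /andP[bA _]; rewrite (disjointFr dAB bA).
Qed.

Lemma mem_Some_imset (A : {set G}) x : (Some x \in Some @: A) = (x \in A).
Proof. by apply: mem_imset; exact: Some_inj. Qed.

Lemma None_notin_Some_imset (A : {set G}) : None \notin Some @: A.
Proof. by apply/imsetP => -[]. Qed.

Lemma mem_SomeU (A : {set G}) x : (Some x \in None |: Some @: A) = (x \in A).
Proof. by rewrite !inE mem_Some_imset. Qed.

Lemma Some_imset_inj : injective (fun A : {set G} => Some @: A).
Proof. by apply: imset_inj; exact: Some_inj. Qed.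

Lemma Some_imsetU_inj : injective (fun A : {set G} => None |: Some @: A).
Proof. by move=> A B /setP eqAB; apply/setP => x; rewrite -!mem_SomeU eqAB. Qed.

Lemma disjoint_dev_infty_dev C D : [disjoint dev_infty C & dev D].
Proof.
apply/pred0P => b /=; apply/negP => /andP[/imsetP[g _ ->] /imsetP[h _]].
by move=> /setP/(_ None); rewrite in_setU set11 !(negPf (None_notin_Some_imset _)).
Qed.

Lemma rep_num_finite_pair C D x y :
  injective (translate C) -> injective (translate D) ->
  rep_num (dev_infty C :|: dev D) [set Some x; Some y] =
    (#|differences C (y - x)%R| + #|differences D (y - x)%R|)%N.
Proof.
move=> injC injD; rewrite rep_numU ?disjoint_dev_infty_dev //.
rewrite rep_num_imset; last exact: (inj_comp Some_imsetU_inj injC).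
rewrite rep_num_imset; last exact: (inj_comp Some_imset_inj injD).
rewrite -!card_containing_pair; congr (_ + _)%N; apply: eq_card => g; rewrite !inE.
  by rewrite subUset !sub1set !mem_SomeU !mem_translate.
by rewrite subUset !sub1set !mem_Some_imset !mem_translate.
Qed.

Lemma rep_num_infinite_pair C D x :
  injective (translate C) -> injective (translate D) ->
  rep_num (dev_infty C :|: dev D) [set None; Some x] = #|C|.
Proof.
move=> injC injD; rewrite rep_numU ?disjoint_dev_infty_dev //.
rewrite rep_num_imset; last exact: (inj_comp Some_imsetU_inj injC).
rewrite rep_num_imset; last exact: (inj_comp Some_imset_inj injD).
rewrite -(card_containing C x) -[RHS]addn0; congr (_ + _)%N.
  apply: eq_card => g.
  by rewrite !inE subUset !sub1set mem_SomeU mem_translate !inE eqxx.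
apply: eq_card0 => g.
by rewrite !inE subUset !sub1set (negPf (None_notin_Some_imset _)).
Qed.

Lemma card_dev_infty_dev_block C (D : {set G}) (b : {set option G}) :
  #|C|.+1 = #|D| -> b \in dev_infty C :|: dev D -> #|b| = #|D|.
Proof.
move=> cardC; rewrite inE => /orP[] /imsetP[g _ ->].
  rewrite cardsU1 None_notin_Some_imset card_imset ?card_translate //.
  exact: Some_inj.
by rewrite card_imset ?card_translate //; exact: Some_inj.
Qed.

End Translates.

(** * Cyclotomic classes and parity of exponents *)

Section CyclotomicClasses.
Set Implicit Arguments.
Unset Strict Implicit.
Unset Printing Implicit Defensive.
Import GRing.Theory.
Local Open Scope ring_scope.

Variables (F : finFieldType) (alpha : F).
Local Notation n := #|F|.-1.
Hypotheses (alpha_prim : n.-primitive_root alpha).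
Hypotheses (n_even : ~~ odd n) (n_gt3 : (3 < n)%N).
Local Notation D i := (cyclotomic_class2 alpha i).
Local Notation C i := (log_shifted_class alpha i).

Lemma logP (x : F) : x != 0 -> exists2 k, (k < n)%N & x = alpha ^+ k.
Proof.
move=> x_neq0; have [|i ->] := prim_rootP alpha_prim (x := x).
  apply: (mulfI x_neq0); rewrite -exprS prednK ?mulr1 ?expf_card //.
  by rewrite -ltnS; apply: leq_trans (ltnW (ltnW (ltnW n_gt3))) _; exact: leq_pred.
by exists i.
Qed.

Lemma alpha_neq0 : alpha != 0.
Proof. by rewrite (prim_root_eq0 alpha_prim) -lt0n; lia. Qed.

(** Since [n] is even, reducing an exponent modulo the order [n] of [alpha] keeps its parity. *)
Lemma mem_class i k : (alpha ^+ k \in D i) = (odd k == odd i).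
Proof.
apply/imsetP/eqP => [[j _ /eqP]|odd_k].
  rewrite -exprM -exprD (eq_prim_root_expr alpha_prim).
  move/eqP/(congr1 odd); rewrite !odd_mod ?(negPf n_even) // oddD.
  by rewrite oddM addbF.
have n_gt0 : (0 < n)%N by lia.
(* Adding [n * i] leaves [alpha ^+ k] unchanged and keeps the subtraction of [i] from truncating. *)
pose m := ((k + n * i - i)./2)%N.
have def_m : (i + 2 * m = k + n * i)%N.
  have le_i : (i <= k + n * i)%N by nia.
  rewrite mul2n even_halfK ?subnKC // oddB // oddD oddM (negPf n_even).
  by rewrite odd_k addbF addbb.
exists (Ordinal (ltn_pmod m n_gt0)) => //=.
rewrite expr_mod; first by rewrite -exprM -exprD def_m exprD exprM
  (prim_expr_order alpha_prim) expr1n mulr1.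
by rewrite -exprM mulnC exprM (prim_expr_order alpha_prim) expr1n.
Qed.

Lemma class_neq0 i x : x \in D i -> x != 0.
Proof.
by case/imsetP => k _ ->; rewrite mulf_neq0 // !expf_neq0 ?alpha_neq0.
Qed.

Lemma mem_class1 x : (x \in D 1) = (x != 0) && (x \notin D 0).
Proof.
have [->|/logP[k _ ->]] := eqVneq x 0; last by rewrite !mem_class; case: odd.
by apply/negP => /class_neq0; rewrite eqxx.
Qed.

Lemma mem_class0_div x y :
  (x / y \in D 0) = (x \in D 0) && (y \in D 0) || (x \in D 1) && (y \in D 1).
Proof.
have zero_class i : (0 \in D i) = false.
  by apply/negP => /class_neq0; rewrite eqxx.
have [->|/logP[k _ ->]] := eqVneq x 0; first by rewrite mul0r !zero_class.
(* Division by [0] gives [0], which lies in no class, so both sides are false when [y = 0]. *)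
have [->|/logP[l l_lt ->]] := eqVneq y 0.
  by rewrite invr0 mulr0 !zero_class !andbF.
have -> : alpha ^+ k / alpha ^+ l = alpha ^+ (k + (n - l)).
  rewrite exprD exprB ?(ltnW l_lt) ?unitfE ?alpha_neq0 //.
  by rewrite (prim_expr_order alpha_prim) mul1r.
rewrite !mem_class oddD oddB ?(ltnW l_lt) // (negPf n_even).
by case: odd; case: odd.
Qed.

(** Multiplication by [alpha] maps [D 0] onto [D 1], and the two classes partition the [n] nonzero
    elements. *)
Lemma card_class i : (i < 2)%N -> #|D i| = n./2.
Proof.
have card01 : #|D 1| = #|D 0|.
  rewrite -[RHS](card_imset _ (mulfI alpha_neq0)); apply: eq_card => x.
  have [->|/logP[k _ ->]] := eqVneq x 0.
    apply/idP/imsetP => [/class_neq0|[y /class_neq0 y0 /eqP]]; first by rewrite eqxx.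
    by rewrite eq_sym mulf_eq0 (negPf alpha_neq0) (negPf y0).
  rewrite mem_class; apply/idP/imsetP => [odd_k|[y /[dup] /class_neq0/logP[l _ ->]]].
    exists (alpha ^+ k.-1); last by rewrite -exprS prednK // odd_gt0 // (eqP odd_k).
    by rewrite mem_class; case: k odd_k => //= k; case: odd.
  rewrite mem_class -exprS => odd_l /eqP.
  rewrite (eq_prim_root_expr alpha_prim) => /eqP/(congr1 odd).
  by rewrite !odd_mod ?(negPf n_even) //= => ->; rewrite (eqP odd_l).
have card_sum : (#|D 0| + #|D 1| = n)%N.
  have -> : n = #|[set~ (0 : F)]| by rewrite cardsC1.
  rewrite -(cardsID (D 0) [set~ 0]); congr (_ + _)%N; apply: eq_card => x.
    by rewrite !inE; case: (boolP (x \in D 0)) => [/class_neq0->|]; rewrite ?andbF.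
  by rewrite mem_class1 !inE andbC.
by case: i => [|[|//]] _; lia.
Qed.

(** * Discrete logarithms and the shifted classes *)

Definition antilog (z : 'Z_n) : F := alpha ^+ z.

(** Elements of ['Z_n] are by definition ordinals below [(Zp_trunc n).+2], the modulus that shows up
    after unfolding. *)
Lemma Zp_modulusE : (Zp_trunc n).+2 = n.
Proof. by rewrite Zp_cast //; lia. Qed.

Lemma antilog_neq0 z : antilog z != 0.
Proof. by rewrite expf_neq0 ?alpha_neq0. Qed.

Lemma antilogD z w : antilog (z + w) = antilog z * antilog w.
Proof.
rewrite /antilog -exprD -[RHS](prim_expr_mod alpha_prim) /=.
by rewrite [X in (_ %% X)%N]Zp_modulusE.
Qed.

Lemma antilog0 : antilog 0 = 1.
Proof. by []. Qed.

Lemma antilog2 : antilog 2%:R = alpha ^+ 2.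
Proof. by rewrite mulr2n antilogD -expr2. Qed.

Lemma antilog_inj : injective antilog.
Proof.
move=> z w /eqP; rewrite (eq_prim_root_expr alpha_prim) => /eqP eq_zw.
have lt_n (u : 'Z_n) : (u < n)%N by rewrite -[X in (_ < X)%N]Zp_modulusE.
by apply: val_inj; rewrite /= -(modn_small (lt_n z)) eq_zw modn_small.
Qed.

Lemma antilog_surj x : x != 0 -> exists z, x = antilog z.
Proof.
case/logP => k k_lt ->; rewrite -[X in (_ < X)%N]Zp_modulusE in k_lt.
by exists (Ordinal k_lt).
Qed.

Lemma mem_log_shifted i z : (z \in C i) = (antilog z + 1 \in D i).
Proof.
rewrite inE; apply/imsetP/idP => [[d dD eq_z]|zD].
  by rewrite /antilog eq_z subrK.
by exists (antilog z + 1); rewrite ?addrK.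
Qed.

(** The bijection is [antilog z + 1]; it misses [1] because [antilog] never vanishes. As [1] is a
    square, only [C 0] loses an element by this. *)
Lemma card_log_shifted i : #|C i| = #|D i :\ 1|.
Proof.
rewrite -(card_imset _ (inj_comp (addIr 1) antilog_inj)) /=.
apply: eq_card => x; rewrite !inE.
apply/imsetP/andP => [[z]|[x_neq1 xD]].
  rewrite mem_log_shifted => zD -> /=; split=> //.
  by rewrite -subr_eq0 addrK antilog_neq0.
have [|z eq_z] := antilog_surj (x := x - 1); first by rewrite subr_eq0.
by exists z; rewrite ?mem_log_shifted /= -eq_z subrK.
Qed.

Lemma card_log_shifted0 : #|C 0| = n./2.-1.
Proof.
rewrite card_log_shifted -(card_class (i := 0)) // [in RHS](cardsD1 1).
by rewrite -[1](expr0 alpha) mem_class.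
Qed.

Lemma card_log_shifted1 : #|C 1| = n./2.
Proof.
rewrite card_log_shifted -(card_class (i := 1)) // [in RHS](cardsD1 1).
by rewrite -[1](expr0 alpha) mem_class.
Qed.

Lemma card_differences_sum w : w != 0 ->
  (#|differences (C 0) w| + #|differences (C 1) w| + (antilog w \in D 0))%N
    = n./2.-1.
Proof.
move=> w_neq0; set c := antilog w.
have c_neq0 : c != 0 by exact: antilog_neq0.
have c_neq1 : c != 1 by rewrite -antilog0 (inj_eq antilog_inj).
(* At the pole [f] takes the default value [0], so [A] excludes it automatically. *)
pose f z := (antilog z + 1) / (antilog z * c + 1).
pose A : {set 'Z_n} := [set z | f z \in D 0].
have mem_shift i z : (z + w \in C i) = (antilog z * c + 1 \in D i).
  by rewrite mem_log_shifted antilogD.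
have mem_A z : (z \in A) = (z \in C 0) && (z + w \in C 0)
    || (z \in C 1) && (z + w \in C 1).
  by rewrite !mem_shift !mem_log_shifted inE mem_class0_div.
(* The two kinds of pairs are told apart by whether [z] lies in [C 0]. *)
have -> : (#|differences (C 0) w| + #|differences (C 1) w|)%N = #|A|.
  have -> : differences (C 0) w = A :&: C 0.
    apply/setP => z; rewrite in_setI mem_A in_set.
    rewrite !mem_log_shifted [_ + 1 \in D 1]mem_class1.
    by case: (_ \in D 0); rewrite ?andbF ?andbT ?orbF.
  have -> : differences (C 1) w = A :\: C 0.
    apply/setP => z; rewrite in_setD mem_A in_set.
    rewrite !mem_log_shifted [_ + 1 \in D 1]mem_class1.
    by case: (_ \in D 0); rewrite ?andbF ?andbT.
  exact: cardsID.
have c1_neq0 : c - 1 != 0 by rewrite subr_eq0.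
have den_neq0 z : z \in A -> antilog z * c + 1 != 0.
  by rewrite inE => /class_neq0; apply: contraNneq; rewrite /f => ->; rewrite invr0 mulr0.
(* The Moebius map has determinant [1 - c], which is nonzero: cross-multiplying leaves
   [(antilog z - antilog u) * (c - 1) = 0]. *)
have f_inj : {in A &, injective f}.
  move=> z u /den_neq0 Dz /den_neq0 Du /eqP; rewrite /f eqr_div // => /eqP eq_f.
  apply/antilog_inj/(mulIf c1_neq0)/eqP; rewrite -subr_eq0; apply/eqP.
  transitivity ((antilog u + 1) * (antilog z * c + 1)
                - (antilog z + 1) * (antilog u * c + 1)); first by ring.
  by rewrite eq_f subrr.
(* The value [1] belongs to the argument [0] and [c^-1] to infinity; neither is an [antilog]. *)
have f_im : f @: A = (D 0 :\ 1) :\ c^-1.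
  apply/setP => y; rewrite 2!in_setD1; apply/imsetP/and3P => [[z zA ->]|].
    split; last by rewrite inE in zA.
      apply: contra c1_neq0 => /eqP eq_f; apply/eqP.
      transitivity (c * (antilog z + 1) - (antilog z * c + 1)); first by ring.
      by rewrite -[antilog z + 1](divfK (den_neq0 _ zA)) -/(f z) eq_f mulVKf // subrr.
    apply: contra (mulf_neq0 (antilog_neq0 z) c1_neq0) => /eqP eq_f; apply/eqP.
    transitivity ((antilog z * c + 1) - (antilog z + 1)); first by ring.
    by rewrite -[antilog z + 1](divfK (den_neq0 _ zA)) -/(f z) eq_f mul1r subrr.
  case=> y_neqcV y_neq1 yD.
  have d_neq0 : c * y - 1 != 0.
    apply: contra y_neqcV; rewrite subr_eq0 => /eqP cy.
    by rewrite -[c^-1]mulr1 -cy mulKf.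
  (* This is the solution [x] of [(x + 1) / (c * x + 1) = y]. *)
  have [|z def_z] := antilog_surj (x := (1 - y) / (c * y - 1)).
    by rewrite mulf_neq0 ?invr_eq0 // subr_eq0 eq_sym.
  have fz : f z = y.
    have cd_neq0 : (1 - y) * c + (c * y - 1) != 0.
      by rewrite (_ : _ + _ = c - 1) //; ring.
    by rewrite /f -def_z; field; rewrite d_neq0 cd_neq0.
  by exists z; rewrite // inE fz.
have one_class : 1 \in D 0 by rewrite -[1](expr0 alpha) mem_class.
(* Hence removing [c^-1] costs one element exactly when [c] is a square. *)
have cV_class : (c^-1 \in D 0) = (c \in D 0).
  by rewrite -div1r mem_class0_div mem_class1 one_class andbF orbF.
rewrite -(card_in_imset f_inj) f_im -(card_class (i := 0)) //.
rewrite [in RHS](cardsD1 1) one_class [in RHS](cardsD1 c^-1) in_setD1 cV_class.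
by rewrite invr_eq1 c_neq1 addnC.
Qed.

Lemma translate_log_shifted_inj i : (i < 2)%N -> injective (translate (C i)).
Proof.
move=> i_lt; apply: translate_inj => w w_neq0.
have card_sum := card_differences_sum w_neq0.
case: i i_lt => [|[|//]] _; last by rewrite card_log_shifted1; lia.
rewrite ltnNge; apply/negP => card_le; have stable := differences_stable card_le.
(* [differences (C 0) w] alone already exhausts the total [n./2.-1]. *)
have diff1_0 : differences (C 1) w = set0.
  by apply/eqP; rewrite -cards_eq0; move: card_le; rewrite card_log_shifted0; lia.
(* Otherwise [z + w] is in [C 0] or [C 1]; [diff1_0] rules out [C 1], and [stable] would put [z]
   itself in [C 0]. *)
have hits_m1 z : z \in C 1 -> antilog (z + w) + 1 = 0.
  move=> zC1; apply/eqP/negPn/negP => neq0.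
  have : z + w \in C 0.
    have := in_set0 z; rewrite -diff1_0 inE zC1 /= !mem_log_shifted mem_class1.
    by rewrite neq0 => /negbFE.
  by move: zC1; rewrite stable !mem_log_shifted mem_class1 => /andP[_ /negPf->].
have : (#|C 1| <= 1)%N.
  apply/card_le1_eqP => z u /hits_m1 z0 /hits_m1 u0.
  by apply/(addIr w)/antilog_inj/(addIr 1); rewrite z0 u0.
by rewrite card_log_shifted1; lia.
Qed.

End CyclotomicClasses.

(** * The adesign property *)

Lemma Zp_two_neq0 n : 2 < n -> (2%:R : 'Z_n)%R != 0%R.
Proof. by case: n => [|[|[|n]]]. Qed.

Theorem theorem3 (q : nat) (F : finFieldType) (alpha : F)
    (q_odd : odd q) (q_gt3 : 3 < q) (cardF : #|F| = q)
    (alpha_prim : ((q.-1).-primitive_root alpha)%R) :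
  is_adesign
    (dev_infty (log_shifted_class alpha 0) :|: dev (log_shifted_class alpha 1))
    2 q (q.-1)./2 (q - 5)./2.
Proof.
subst q; have n_even : ~~ odd #|F|.-1 by move: q_odd; case: #|F|.
have n_gt3 : 3 < #|F|.-1 by lia.
have inj0 := translate_log_shifted_inj alpha_prim n_even n_gt3 (i := 0) isT.
have inj1 := translate_log_shifted_inj alpha_prim n_even n_gt3 (i := 1) isT.
have card0 := card_log_shifted0 alpha_prim n_even n_gt3.
have card1 := card_log_shifted1 alpha_prim n_even n_gt3.
have two : (2%:R : 'Z_(#|F|.-1))%R != 0%R by apply: Zp_two_neq0; lia.
split.
- by rewrite card_option card_ord Zp_cast; lia.
- by move=> b /card_dev_infty_dev_block ->; rewrite ?card0 ?card1; lia.
- move=> T /eqP/cards2P[x [y [neq_xy ->]]].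
  case: x y neq_xy => [x|] [y|] // neq_xy.
  + have w_neq0 : (y - x)%R != 0%R.
      by rewrite GRing.subr_eq0 eq_sym; apply: contraNneq neq_xy => ->.
    have := card_differences_sum alpha_prim n_even n_gt3 w_neq0.
    by rewrite rep_num_finite_pair //; case: (_ \in _); lia.
  + by right; rewrite [[set Some x; None]]setUC rep_num_infinite_pair // card0; lia.
  + by right; rewrite rep_num_infinite_pair // card0; lia.
(* The difference [2] has antilogarithm [alpha ^+ 2], a square, so this pair attains the smaller
   count. *)
- exists [set Some 0%R; Some 2%:R%R]; rewrite cards2; split.
    by rewrite (inj_eq Some_inj) eq_sym two.
  have := card_differences_sum alpha_prim n_even n_gt3 two.
  rewrite antilog2 // mem_class // rep_num_finite_pair // GRing.subr0 => eq_sum.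
  by apply: (@addIn 1); rewrite eq_sum; lia.
(* Pairs with the new point lie in [#|C 0|] blocks, that is [(q - 3) / 2], the larger count. *)
- exists [set None; Some 0%R]; rewrite cards2; split=> //.
  by rewrite rep_num_infinite_pair // card0; lia.
Qed.
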